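(* Let $T$ be a tree and $v$ a vertex of $T$. Then $T$ satisfies $$N_{v}N_{T}-N_{v}^{2}+N_{T}-N_{v}\ge 3(R_{T}-R_{v}),$$ which is equivalent to $$\mu_{T-v}:=\frac{R_{T}-R_{v}}{N_{T}-N_{v}}\le\frac{N_{v}+1}{3}.$$
   Context: A subtree of a tree $T$ is a nonempty connected subgraph of $T$ (single vertices and $T$ itself are included); its order (cardinality) is its number of vertices. $N_T$ is the number of subtrees of $T$ and $R_T$ is the sum of the orders of all subtrees of $T$. $N_v$ is the number of subtrees of $T$ containing the vertex $v$, and $R_v$ is the sum of the orders of all subtrees of $T$ containing $v$. $T-v$ is the graph obtained from $T$ by removing $v$; it can be a forest, i.e., a union of several disjoint trees. $\mu_{T-v}$ is the global mean of $T-v$, i.e., the average order of the subtrees of $T$ not containing $v$. *)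

(* Defs.v *)
From mathcomp Require Import all_boot all_order all_algebra.

Set Implicit Arguments.
Unset Strict Implicit.
Unset Printing Implicit Defensive.

Import Order.TTheory GRing.Theory Num.Theory.

Section Trees.

(* A finite graph is given by its adjacency relation on a finite vertex type. *)
Variables (V : finType) (e : rel V).

(* A cycle has at least three vertices: ucycle e [:: x; y] holds for every
   edge xy of an undirected graph. *)
Definition is_tree : Prop :=
  [/\ symmetric e, irreflexive e, 0 < #|V|,
      forall x y, connect e x y
    & forall c : seq V, 2 < size c -> ~~ ucycleb e c].

Definition edges : {set {set V}} :=
  [set [set p.1; p.2] | p : V * V & e p.1 p.2].

(* H.1 is the vertex set of H and H.2 its edge set; subgraphs need not be
   induced. *)
Definition is_subgraph (H : {set V} * {set {set V}}) : bool :=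
  (H.2 \subset edges) && [forall E in H.2, E \subset H.1].

Definition is_connected (H : {set V} * {set {set V}}) : bool :=
  [forall x in H.1, forall y in H.1,
     connect (fun a b => [set a; b] \in H.2) x y].

Definition subtrees : {set {set V} * {set {set V}}} :=
  [set H | [&& H.1 != set0, is_subgraph H & is_connected H]].

Definition subtrees_at (v : V) := [set H in subtrees | v \in H.1].

Definition subtrees_avoiding (v : V) := [set H in subtrees | v \notin H.1].

Definition sum_orders (A : {set {set V} * {set {set V}}}) : nat :=
  \sum_(H in A) #|H.1|.

Definition N_tree : nat := #|subtrees|.
Definition R_tree : nat := sum_orders subtrees.
Definition N_at (v : V) : nat := #|subtrees_at v|.
Definition R_at (v : V) : nat := sum_orders (subtrees_at v).

(* Global mean of the forest obtained by deleting v; meaningful only when v is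
   not the only vertex. *)
Definition mu_del (v : V) : rat :=
  ((sum_orders (subtrees_avoiding v))%:R / #|subtrees_avoiding v|%:R)%R.

End Trees.

(* Main.v *)
Require Import Defs.
From mathcomp Require Import all_boot all_order all_algebra.
From mathcomp Require Import zify ring.
Import Order.TTheory GRing.Theory Num.Theory.

(** In a tree a subtree is determined by its vertex set, so subtrees may be
    counted as nonempty connected vertex sets. For a tree with root v, let n and
    m be the numbers of such sets that contain v and that avoid v, and let r
    and s be the corresponding sums of orders. The claim is 3s <= (n+1)m.

    It is proved by induction on the way in which the tree is glued together
    from rooted trees: cutting an edge vu leaves a tree B with root v and a tree
    C with root u. A connected set that contains v is a connected set of B that
    contains v, possibly joined to a connected set of C that contains u. One
    that avoids v lies on one side of the edge. With primes for C and
    capitals for the whole tree, so that n, r, m, s belong to B, this gives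
    N = n(1+n'), R = r(1+n') + nr', M = m+m'+n' and S = s+s'+r'
    ([rooted_sets_graft], [unrooted_sets_graft]).

    The sets of C that contain u avoid v, so the bound on S needs a bound on r'.
    What suffices is 3r <= m + n(n+2), for every rooted tree: a lower bound on
    the number of sets that avoid the root. In turn, propagating that inequality
    needs 2r <= n(n+1), i.e. the mean order of the sets that contain the root is
    at most (n+1)/2. The three inequalities together are preserved by gluing
    ([graft_mean_bounds]); all are equalities for a path rooted at an end.

    Acyclicity enters only through [acyclic_connect]: the ends of an edge xy are
    not connected in a subgraph that lacks xy. It gives both that subtrees are
    induced subgraphs ([subtree_induced]) and that cutting an edge
    separates a tree ([connected_rooted_tree]). *)

Set Implicit Arguments.
Unset Strict Implicit.
Unset Printing Implicit Defensive.

(** * Preliminaries *)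

Lemma connect_invariant (T : finType) (r : rel T) (P : T -> Prop) x y :
  connect r x y -> P x -> (forall a b, P a -> r a b -> P b) -> P y.
Proof.
case/connectP=> p + -> + Pstep.
by elim: p x => //= z p IHp x /andP[rxz /IHp{}IHp] Px; apply/IHp/(Pstep x).
Qed.

Lemma sum_disjoint_setU (T : finType) (A B : {set T}) (F : T -> nat) :
  [disjoint A & B] ->
  \sum_(x in A :|: B) F x = \sum_(x in A) F x + \sum_(x in B) F x.
Proof. by move=> dAB; rewrite -bigU //; apply: eq_bigl => x; rewrite !inE. Qed.

(** The recurrences for gluing a tree (primed) to the root of another one. For
    the first bound use n' <= nn'. For the third, N >= n' + 1 reduces the
    contribution of the grafted tree to the sum of its own second and third
    bounds. For the second, eliminate m and m' by their bounds; then r and r'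
    occur with coefficients -3n' and -3(n-1), so that the worst case is
    2r = n(n+1) and 2r' = n'(n'+1), where the difference of the two sides is
    n'(n-1)((n-1) + n'(2n-1))/2. *)
Lemma graft_mean_bounds n r m s n' r' m' s' : 0 < n ->
  [/\ 2 * r <= n * n.+1, 3 * r <= m + n * n.+2 & 3 * s <= n.+1 * m] ->
  [/\ 2 * r' <= n' * n'.+1, 3 * r' <= m' + n' * n'.+2 & 3 * s' <= n'.+1 * m'] ->
  let N := n * n'.+1 in
  let R := r * n'.+1 + n * r' in
  let M := m + (m' + n') in
  let S := s + (s' + r') in
  [/\ 2 * R <= N * N.+1, 3 * R <= M + N * N.+2 & 3 * S <= N.+1 * M].
Proof.
case: n => // k _ [r_le m_ge s_le] [r'_le m'_ge s'_le] /=.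
split; [nia | | nia].
(* These products are the elimination of r and r', with n = k+1. *)
have A1 : n' * (2 * r) <= n' * (k.+1 * k.+2) by rewrite leq_mul2l r_le orbT.
have A2 : k * (2 * r') <= k * (n' * n'.+1) by rewrite leq_mul2l r'_le orbT.
nia.
Qed.

(** * Connected vertex sets in a tree glued along an edge *)

Section ConnectedSets.

Variables (V : finType) (e : rel V).
Hypothesis eC : symmetric e.

Implicit Types (A B C S : {set V}) (x y z u v : V).

Definition within S x y : bool := [&& x \in S, y \in S & e x y].

Definition connected S : bool :=
  [forall x in S, forall y in S, connect (within S) x y].

Lemma withinC S : symmetric (within S).
Proof. by move=> x y; rewrite /within eC andbCA. Qed.

Lemma connect_withinC S : connect_sym (within S).
Proof. exact/sym_connect_sym/withinC. Qed.

(** With undirected edges, connectedness can be tested from one vertex. *)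
Lemma connected_rooted S v : v \in S ->
  reflect (forall x, x \in S -> connect (within S) v x) (connected S).
Proof.
move=> vS; apply: (iffP forall_inP) => [cS x xS|cS x xS].
  by have /forall_inP := cS v vS; apply.
apply/forall_inP=> y yS; apply: connect_trans (cS y yS).
by rewrite connect_withinC cS.
Qed.

Lemma connected1 v : connected [set v].
Proof. by apply/(@connected_rooted _ v) => [|x]; rewrite in_set1 // => /eqP->. Qed.

Lemma connect_within_sub S A x y :
  S \subset A -> connect (within S) x y -> connect (within A) x y.
Proof.
move/subsetP=> sSA; apply: connect_sub => a b /and3P[aS bS eab].
by apply: connect1; rewrite /within !sSA.
Qed.

Definition rooted_sets A v :=
  [set S : {set V} | [&& S \subset A, v \in S & connected S]].

Definition unrooted_sets A v :=
  [set S : {set V} | [&& S \subset A, v \notin S, S != set0 & connected S]].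

(** A vertex set that can be assembled from single vertices by adding an edge
    from the root of one tree to the root of another, keeping the first root.
    This is the recursive structure over which sets are counted; it splits off
    one branch at the root at a time rather than all of them. *)
Inductive rooted_tree : {set V} -> V -> Prop :=
| Leaf v : rooted_tree [set v] v
| Graft B v C u of rooted_tree B v & rooted_tree C u & [disjoint B & C] &
    e v u & (forall x y, x \in B -> y \in C -> e x y -> x = v /\ y = u) :
    rooted_tree (B :|: C) v.

Lemma root_in_tree A v : rooted_tree A v -> v \in A.
Proof. by elim=> [w|B w C u _ wB _ _ _ _ _]; rewrite ?inE ?eqxx ?wB. Qed.

Section Graft.

Variables (B C : {set V}) (v u : V).
Hypotheses (vB : v \in B) (uC : u \in C) (dBC : [disjoint B & C]) (evu : e v u).
Hypothesis crossE : forall x y, x \in B -> y \in C -> e x y -> x = v /\ y = u.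

Let notBC x : x \in B -> x \in C -> False.
Proof. by move=> xB xC; have /pred0P/(_ x) := dBC; rewrite /= xB xC. Qed.

(** A walk in S from v crosses between B and C only along vu. So the part of
    the walk inside B up to any moment still links v to the current vertex when
    that lies in B, and otherwise u has been visited and is linked to it in C. *)
Lemma connected_graft_split S : S \subset B :|: C -> v \in S -> connected S ->
  connected (S :&: B) /\
    (S :&: C = set0 \/ u \in S :&: C /\ connected (S :&: C)).
Proof.
move=> /subsetP sS vS /(connected_rooted vS) cS.
(* Invariant along a walk in S that starts at v. *)
pose P x := (x \in B -> connect (within (S :&: B)) v x) /\
  (x \in C -> u \in S /\ connect (within (S :&: C)) u x).
have inv x : x \in S -> P x.
  move=> /cS cvx; apply: (connect_invariant cvx).
    by split=> // vC; case: (notBC vB vC).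
  move=> a b [IB IC] /= /and3P[aS bS eab].
  have /setUP[aB|aC] := sS a aS; split=> [bB|bC].
  - apply: connect_trans (IB aB) (connect1 _).
    by rewrite /within !inE aS aB bS bB.
  - by have [_ <-] := crossE aB bC eab.
  - by have [-> _] := crossE bB aC (etrans (eC _ _) eab).
  - have [uS cua] := IC aC; split=> //.
    apply: connect_trans cua (connect1 _).
    by rewrite /within !inE aS aC bS bC.
split.
  apply/(@connected_rooted _ v); first by rewrite inE vS.
  by move=> x /setIP[/inv[IB _] /IB].
have [->|[x /setIP[/inv[_ IC] xC]]] := set_0Vmem (S :&: C); first by left.
right; have [uS _] := IC xC; have uSC : u \in S :&: C by rewrite inE uS.
split=> //; apply/(connected_rooted uSC) => y /setIP[/inv[_ ICy] yC].
by have [] := ICy yC.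
Qed.

Lemma connected_graft S1 S2 : v \in S1 -> connected S1 ->
  u \in S2 -> connected S2 -> connected (S1 :|: S2).
Proof.
move=> v1 /(connected_rooted v1) c1 u2 /(connected_rooted u2) c2.
have vS : v \in S1 :|: S2 by rewrite inE v1.
apply/(connected_rooted vS) => x /setUP[/c1|/c2].
  exact/connect_within_sub/subsetUl.
move/(connect_within_sub (subsetUr S1 S2)); apply/connect_trans/connect1.
by rewrite /within !inE v1 u2 orbT.
Qed.

(** Passing from one side to the other would use the edge vu, hence v. *)
Lemma connected_side S : S \subset B :|: C -> v \notin S -> connected S ->
  S \subset B \/ S \subset C.
Proof.
move=> /subsetP sS vS cS; have [->|[x xS]] := set_0Vmem S.
  by left; exact: sub0set.
move: cS => /(connected_rooted xS) cS.
have /setUP[xB|xC] := sS x xS; [left|right]; apply/subsetP=> y /cS cxy;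
  [apply: (connect_invariant (P := fun z => z \in B) cxy)
  |apply: (connect_invariant (P := fun z => z \in C) cxy)] => // a b aX;
  move=> /and3P[aS bS eab]; have /setUP[bB|bC] := sS b bS => //.
- by have [av _] := crossE aX bC eab; rewrite -av aS in vS.
- have [bv _] := crossE bB aX (etrans (eC _ _) eab).
  by rewrite -bv bS in vS.
Qed.

(** The correspondence S |-> (S :&: B, S :&: C), where the second component is
    either empty or a connected set that contains u. The weight F is 1 for
    numbers of sets and the cardinal for sums of orders. *)
Lemma rooted_sets_graft (F : {set V} -> nat) :
  \sum_(S in rooted_sets (B :|: C) v) F S =
  \sum_(S1 in rooted_sets B v)
    (F S1 + \sum_(S2 in rooted_sets C u) F (S1 :|: S2)).
Proof.
pose D := setX (rooted_sets B v) (set0 |: rooted_sets C u).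
pose join (p : {set V} * {set V}) := p.1 :|: p.2.
have BC0 S1 S2 : S1 \subset B -> S2 \subset C ->
    (S1 :|: S2) :&: B = S1 /\ (S1 :|: S2) :&: C = S2.
  move=> s1 s2; rewrite !setIUl (setIidPl s1) (setIidPl s2).
  have d12 : S2 :&: B = set0.
    apply/eqP; rewrite setI_eq0 disjoint_sym.
    exact: disjointWr dBC.
  have d21 : S1 :&: C = set0.
    apply/eqP; rewrite setI_eq0.
    exact: disjointWl dBC.
  by rewrite d12 d21 setU0 set0U.
have DP p : p \in D -> p.1 \subset B /\ p.2 \subset C.
  case: p => S1 S2; rewrite !inE /= => /andP[/and3P[-> _ _]].
  by case/orP=> [/eqP->|/and3P[-> _ _]]; rewrite ?sub0set.
have join_inj : {in D &, injective join}.
  move=> [S1 S2] [S3 S4] /DP[/= s1 s2] /DP[/= s3 s4].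
  rewrite /join /= => eqS; have [] := BC0 _ _ s1 s2; rewrite eqS.
  by have [-> ->] := BC0 _ _ s3 s4 => -> ->.
have -> : rooted_sets (B :|: C) v = join @: D.
  apply/setP=> S; apply/idP/imsetP.
    rewrite inE => /and3P[sS vS cS].
    have [c1 c2] := connected_graft_split sS vS cS.
    exists (S :&: B, S :&: C); last by rewrite /join /= -setIUr (setIidPl sS).
    rewrite !inE /= subsetIr vS vB c1 /= subsetIr.
    by case: c2 => [->|[]]; rewrite ?eqxx // inE => -> ->; rewrite orbT.
  case=> -[S1 S2]; rewrite !inE /= => /andP[/and3P[s1 v1 c1] S2P] ->.
  have [/eqP->|/and3P[s2 u2 c2]] := orP S2P.
    by rewrite /join /= setU0 v1 c1 subsetU // s1.
  by rewrite /join /= setUSS // inE v1 /= connected_graft.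
rewrite big_imset //=.
rewrite (eq_bigl (fun p => (p.1 \in rooted_sets B v) &&
  (p.2 \in set0 |: rooted_sets C u))); last by case=> S1 S2; rewrite in_setX.
rewrite -(pair_big _ _ (fun S1 S2 => F (S1 :|: S2))) /=; apply: eq_bigr => S1 _.
rewrite big_setU1 ?setU0 //=; last by rewrite !inE andbF.
Qed.

(** Sets on the side of C automatically avoid v, but may or may not contain u. *)
Lemma unrooted_sets_graft (F : {set V} -> nat) :
  \sum_(S in unrooted_sets (B :|: C) v) F S =
  \sum_(S in unrooted_sets B v) F S +
  (\sum_(S in unrooted_sets C u) F S + \sum_(S in rooted_sets C u) F S).
Proof.
have vC : v \notin C by apply/negP=> /(notBC vB).
have -> : unrooted_sets (B :|: C) v =
    unrooted_sets B v :|: (unrooted_sets C u :|: rooted_sets C u).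
  apply/setP=> S; rewrite !inE; apply/idP/idP.
    move=> /and4P[sS vS S0 cS]; rewrite vS S0 cS.
    have [->|->] := connected_side sS vS cS; rewrite //= !andbT.
    by rewrite orNb orbT.
  case/orP=> [/and4P[sS -> -> ->]|]; first by rewrite subsetU // sS.
  case/orP=> [/and4P[sS _ -> ->]|/and3P[sS uS ->]];
    rewrite ?(contra (subsetP sS v)) // subsetU ?sS ?orbT //=.
  by rewrite andbT; apply/set0Pn; exists u.
rewrite !sum_disjoint_setU // disjoint_subset; apply/subsetP=> S; rewrite !inE.
  by case/and4P=> _ /negbTE-> _ _; rewrite andbF.
case/and4P=> /subsetP sB _ /set0Pn[x xS] _; apply/negP.
by case/orP=> [/and4P[/subsetP sC _ _ _]|/and3P[/subsetP sC _ _]];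
  case: (notBC (sB x xS) (sC x xS)).
Qed.

End Graft.

Lemma rooted_sets_gt0 (A : {set V}) v : rooted_tree A v ->
  0 < #|rooted_sets A v|.
Proof.
move/root_in_tree=> vA; apply/card_gt0P; exists [set v].
by rewrite inE sub1set vA set11 connected1.
Qed.

Lemma tree_mean_bounds A v : rooted_tree A v ->
  let n := #|rooted_sets A v| in
  let r := \sum_(S in rooted_sets A v) #|S| in
  let m := #|unrooted_sets A v| in
  let s := \sum_(S in unrooted_sets A v) #|S| in
  [/\ 2 * r <= n * n.+1, 3 * r <= m + n * n.+2 & 3 * s <= n.+1 * m].
Proof.
elim=> {A v} [v|B v C u tB IHB tC IHC dBC evu crossE].
  have -> : rooted_sets [set v] v = [set [set v]].
    apply/setP=> S; rewrite !inE subset1; apply/idP/eqP.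
      by case/and3P=> /orP[/eqP->|/eqP->]; rewrite ?inE.
    by move=> ->; rewrite eqxx set11 connected1.
  have -> : unrooted_sets [set v] v = set0.
    apply/setP=> S; rewrite !inE subset1.
    by case: eqP => [->|_] //=; [rewrite set11|case: eqP => [->|]; rewrite ?andbF].
  by rewrite !big_set1 !big_set0 !cards1 cards0.
have [vB uC] := (root_in_tree tB, root_in_tree tC).
move: IHB IHC (rooted_sets_gt0 tB).
have sums F := (@rooted_sets_graft B C v u vB uC dBC evu crossE F,
                @unrooted_sets_graft B C v u vB dBC crossE F).
have -> : #|rooted_sets (B :|: C) v| =
    #|rooted_sets B v| * #|rooted_sets C u|.+1.
  by rewrite -sum1_card sums sum_nat_const sum1_card.
have -> : #|unrooted_sets (B :|: C) v| =
    #|unrooted_sets B v| + (#|unrooted_sets C u| + #|rooted_sets C u|).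
  by rewrite -!sum1_card sums.
have -> : \sum_(S in rooted_sets (B :|: C) v) #|S| =
    (\sum_(S in rooted_sets B v) #|S|) * #|rooted_sets C u|.+1 +
    #|rooted_sets B v| * \sum_(S in rooted_sets C u) #|S|.
  rewrite sums -sum_nat_const big_distrl -big_split /=.
  apply: eq_bigr => S1; rewrite inE => /and3P[s1 _ _].
  rewrite mulnS -addnA; congr (_ + _).
  rewrite mulnC -sum_nat_const -big_split; apply: eq_bigr => S2.
  rewrite inE => /and3P[s2 _ _].
  rewrite cardsU (_ : S1 :&: S2 = set0) ?cards0 ?subn0 //.
  by apply/eqP; rewrite setI_eq0; exact: disjointW dBC.
rewrite sums.
move: #|rooted_sets B v| #|unrooted_sets B v| (\sum_(S in rooted_sets B v) _)
      (\sum_(S in unrooted_sets B v) _) => n m r s.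
move: #|rooted_sets C u| #|unrooted_sets C u| (\sum_(S in rooted_sets C u) _)
      (\sum_(S in unrooted_sets C u) _) => n' m' r' s'.
by move=> IHB IHC n_gt0; exact: graft_mean_bounds.
Qed.

(** * Acyclic graphs *)

Section Acyclic.

Hypothesis eI : irreflexive e.
Hypothesis acyclic : forall c : seq V, 2 < size c -> ~~ ucycleb e c.

(** A simple path of r from x to y that is not the edge xy itself has at least
    two edges, and closing it by the edge yx gives a cycle of e. *)
Lemma acyclic_connect (r : rel V) x y :
  subrel r e -> e x y -> connect r x y -> r x y.
Proof.
move=> sre exy /connectP[p0 rp0 yE]; move: exy; rewrite {}yE.
case/shortenP: rp0 => p + + _ {p0}.
case: p => [|a [|b p]] rp Up exy.
- by rewrite /= eI in exy.
- by case/andP: rp.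
have /negP[] := acyclic (c := [:: x, a, b & p]) isT.
rewrite /ucycleb Up andbT /= rcons_path (eC _ x) exy andbT.
by move: rp => /= /and3P[/sre-> /sre-> /(sub_path sre)->].
Qed.

(** If A is not reduced to v, choose a neighbour u of v in A and remove the edge
    vu: by [acyclic_connect] the components of v and u are distinct, and they
    cover A because only one edge was removed. Both are smaller than A. *)
Lemma connected_rooted_tree A v : v \in A -> connected A -> rooted_tree A v.
Proof.
have [n] := ubnP #|A|; elim: n A v => // n IHn A v leAn vA cA.
have [sAv|/subsetPn[w wA wv]] := boolP (A \subset [set v]).
  suff -> : A = [set v] by constructor.
  by apply/eqP; rewrite eqEsubset sAv sub1set.
have [u uA evu] : exists2 u, u \in A & e v u.
  move: cA => /(connected_rooted vA)/(_ w wA)/connectP[[|u p] /=].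
    by move=> _ wE; rewrite wE set11 in wv.
  by case/andP=> /and3P[_ uA evu] _ _; exists u.
pose r : rel V := fun x y => within A x y && ([set x; y] != [set v; u]).
have rC : symmetric r by move=> x y; rewrite /r withinC setUC.
have crC := sym_connect_sym rC.
have sre : subrel r e by move=> x y /andP[/and3P[]].
(* The component of x in A once the edge vu is removed. *)
pose D x := [set z | connect r x z].
have xD x : x \in D x by rewrite inE.
have Dr x a b : a \in D x -> r a b -> b \in D x.
  by rewrite !inE => cxa /connect1; apply: connect_trans.
have sDA x : x \in A -> D x \subset A.
  move=> xA; apply/subsetP=> z; rewrite inE => cxz.
  by apply: (connect_invariant (P := fun z => z \in A) cxz) => // a b _;
    case/andP=> /and3P[].
have cD x : x \in A -> connected (D x).
  move=> xA; apply/(connected_rooted (xD x)) => z; rewrite inE => cxz.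
  suff [] : z \in D x /\ connect (within (D x)) x z by [].
  apply: (connect_invariant
    (P := fun z => z \in D x /\ connect (within (D x)) x z) cxz) => //.
  move=> a b [aD ca] rab; have bD := Dr _ _ _ aD rab; split=> //.
  apply: connect_trans ca (connect1 _).
  by rewrite /within aD bD (sre _ _ rab).
have dD : [disjoint D v & D u].
  apply/pred0P=> z /=; rewrite !inE; apply/negP=> /andP[cvz].
  rewrite crC => /(connect_trans cvz) /(acyclic_connect sre evu).
  by rewrite /r eqxx andbF.
have vNDu : v \notin D u.
  by apply/negP=> vDu; have /pred0P/(_ v) := dD; rewrite /= xD vDu.
have uNDv : u \notin D v.
  by apply/negP=> uDv; have /pred0P/(_ u) := dD; rewrite /= xD uDv.
have AE : A = D v :|: D u.
  apply/eqP; rewrite eqEsubset subUset !sDA // !andbT; apply/subsetP=> z.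
  move: cA => /(connected_rooted vA) cA /cA cvz.
  apply: (connect_invariant (P := fun z => z \in D v :|: D u) cvz).
    by rewrite inE xD.
  move=> a b aD wab; have [Eab|nEab] := eqVneq [set a; b] [set v; u].
    have : b \in [set v; u] by rewrite -Eab !inE eqxx orbT.
    by case/set2P=> ->; rewrite inE xD ?orbT.
  have rab : r a b by rewrite /r wab.
  by rewrite inE; case/setUP: aD => /Dr/(_ rab)->; rewrite ?orbT.
have ltD x y : y \in A -> x \in A -> y \notin D x -> #|D x| < n.
  move=> yA xA yD; rewrite -ltnS; apply: leq_trans leAn; rewrite ltnS.
  apply: proper_card.
  by rewrite properE sDA //; apply/subsetPn; exists y.
rewrite AE; apply: (Graft (u := u)) => //.
- by apply: IHn; rewrite ?cD ?xD ?(ltD v u).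
- by apply: IHn; rewrite ?cD ?xD ?(ltD u v).
move=> x y xDv yDu exy.
have [xA yA] := (subsetP (sDA v vA) x xDv, subsetP (sDA u uA) y yDu).
have [Exy|nExy] := eqVneq [set x; y] [set v; u]; last first.
  have rxy : r x y by rewrite /r /within xA yA exy.
  by have /pred0P/(_ y) := dD; rewrite /= yDu (Dr _ _ _ xDv rxy).
have /set2P[xv|xu] : x \in [set v; u] by rewrite -Exy set21.
  split=> //; have /set2P[yv|//] : y \in [set v; u] by rewrite -Exy set22.
  by rewrite -yv yDu in vNDu.
by rewrite xu (negbTE uNDv) in xDv.
Qed.

Definition induced_edges S := [set E in edges e | E \subset S].

Lemma edgesP x y : ([set x; y] \in edges e) = e x y.
Proof.
apply/imsetP/idP=> [[[a b]]|exy]; last by exists (x, y); rewrite ?inE.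
rewrite inE /= => eab Exy.
have xP : x \in [set a; b] by rewrite -Exy set21.
have yP : y \in [set a; b] by rewrite -Exy set22.
have aP : a \in [set x; y] by rewrite Exy set21.
have bP : b \in [set x; y] by rewrite Exy set22.
case/set2P: xP => xE; case/set2P: yP => yE; move: aP bP; rewrite xE yE => aP bP.
- by case/set2P: bP => bE; rewrite bE in eab.
- by [].
- by rewrite eC.
- by case/set2P: aP => aE; rewrite aE in eab.
Qed.

Lemma induced_edgesP S x y : ([set x; y] \in induced_edges S) = within S x y.
Proof. by rewrite inE edgesP subUset !sub1set andbC -andbA. Qed.

(** The ends of an edge inside the vertex set of H are connected in H, so by
    [acyclic_connect] the edge belongs to H. *)
Lemma subtree_induced H : H \in subtrees e -> H.2 = induced_edges H.1.
Proof.
rewrite inE => /and3P[_ /andP[sHe /forall_inP sH] cH].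
apply/eqP; rewrite eqEsubset; apply/andP; split.
  by apply/subsetP=> E EH; rewrite inE (subsetP sHe) ?sH.
apply/subsetP=> E; rewrite inE => /andP[/imsetP[[x y]]].
rewrite inE /= => exy ->; rewrite subUset !sub1set => /andP[xH yH].
apply: (@acyclic_connect (fun a b => [set a; b] \in H.2)) => //.
  by move=> a b /(subsetP sHe); rewrite edgesP.
by move: cH => /forall_inP/(_ x xH)/forall_inP/(_ y yH).
Qed.

Lemma subtree_connected S :
  ((S, induced_edges S) \in subtrees e) = (S != set0) && connected S.
Proof.
rewrite inE /=; congr (_ && _).
have -> /= : is_subgraph e (S, induced_edges S).
  apply/andP; split; first by apply/subsetP=> E; rewrite inE => /andP[].
  by apply/forall_inP=> E; rewrite inE => /andP[].
apply: eq_forallb_in => x _; apply: eq_forallb_in => y _.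
by apply: eq_connect => a b; rewrite induced_edgesP.
Qed.

Lemma sum_subtrees (P : pred {set V}) (F : {set V} -> nat) :
  \sum_(H in subtrees e | P H.1) F H.1 =
  \sum_(S : {set V} | [&& S != set0, connected S & P S]) F S.
Proof.
rewrite (reindex_onto (fun S => (S, induced_edges S)) fst) /=.
  by apply: eq_bigl => S; rewrite subtree_connected eqxx andbT -andbA.
by case=> S E /andP[/subtree_induced /= ->].
Qed.

Lemma sum_subtrees_at v (F : {set V} -> nat) :
  \sum_(H in subtrees_at e v) F H.1 = \sum_(S in rooted_sets [set: V] v) F S.
Proof.
under eq_bigl => H do rewrite inE.
rewrite (sum_subtrees (fun S => v \in S)); apply: eq_bigl => S.
rewrite inE subsetT /= andbA andbC; apply: andb_id2l => vS.
by rewrite andb_idl // => _; apply/set0Pn; exists v.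
Qed.

Lemma sum_subtrees_avoiding v (F : {set V} -> nat) :
  \sum_(H in subtrees_avoiding e v) F H.1 =
  \sum_(S in unrooted_sets [set: V] v) F S.
Proof.
under eq_bigl => H do rewrite inE.
rewrite (sum_subtrees (fun S => v \notin S)); apply: eq_bigl => S.
by rewrite inE subsetT /= andbA andbC.
Qed.

End Acyclic.

Lemma sum_subtrees_split v (F : {set V} * {set {set V}} -> nat) :
  \sum_(H in subtrees e) F H =
  \sum_(H in subtrees_at e v) F H + \sum_(H in subtrees_avoiding e v) F H.
Proof.
rewrite (bigID (fun H : {set V} * {set {set V}} => v \in H.1)) /=.
by congr (_ + _); apply: eq_bigl => H; rewrite [in RHS]inE.
Qed.

End ConnectedSets.

(** * The bound on the global mean of the vertex-deleted tree *)

Lemma tree_global_mean_bound (V : finType) (e : rel V) (v : V) : is_tree e ->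
  3 * sum_orders (subtrees_avoiding e v) <=
  (N_at e v).+1 * #|subtrees_avoiding e v|.
Proof.
case=> eC eI _ econn acyclic.
have cT : connected e [set: V].
  apply/forall_inP=> x _; apply/forall_inP=> y _.
  by rewrite (eq_connect (e' := e)) // => a b; rewrite /within !in_setT.
have tT := connected_rooted_tree eC eI acyclic (in_setT v) cT.
have [_ _] := tree_mean_bounds eC tT.
have atE := sum_subtrees_at eC eI acyclic v.
have avE := sum_subtrees_avoiding eC eI acyclic v.
rewrite /N_at /sum_orders (avE (fun S => #|S|)).
by rewrite -!sum1_card (atE (fun=> 1)) (avE (fun=> 1)).
Qed.

Lemma subtrees_avoiding_gt0 (V : finType) (e : rel V) (v : V) :
  is_tree e -> 1 < #|V| -> 0 < #|subtrees_avoiding e v|.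
Proof.
case=> eC eI _ _ acyclic V_gt1.
have [w wv] : exists w, w != v.
  apply/existsP; apply: contraLR V_gt1 => /existsPn allv.
  rewrite -leqNgt -(cards1 v); apply/subset_leq_card/subsetP=> w _.
  by rewrite inE; have := allv w; rewrite negbK.
apply/card_gt0P; exists ([set w], induced_edges e [set w]).
rewrite inE subtree_connected //= connected1 // in_set1 [v == w]eq_sym wv !andbT.
by apply/set0Pn; exists w; rewrite set11.
Qed.

Local Open Scope ring_scope.

Theorem lemma1p4 (V : finType) (e : rel V) (hT : is_tree e) (v : V) :
  let NT : rat := (N_tree e)%:R in
  let RT : rat := (R_tree e)%:R in
  let Nv : rat := (N_at e v)%:R in
  let Rv : rat := (R_at e v)%:R in
  Nv * NT - Nv ^+ 2 + NT - Nv >= 3 * (RT - Rv) /\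
  ((1 < #|V|)%N ->
     mu_del e v = (RT - Rv) / (NT - Nv) /\
     (Nv * NT - Nv ^+ 2 + NT - Nv >= 3 * (RT - Rv) <->
        (RT - Rv) / (NT - Nv) <= (Nv + 1) / 3) /\
     mu_del e v <= (Nv + 1) / 3).
Proof.
move=> NT RT Nv Rv.
pose m : rat := #|subtrees_avoiding e v|%:R.
pose s : rat := (sum_orders (subtrees_avoiding e v))%:R.
have dN : NT - Nv = m.
  rewrite /NT /N_tree -sum1_card (sum_subtrees_split _ v) !sum1_card natrD.
  by rewrite addrAC subrr add0r.
have dR : RT - Rv = s.
  rewrite /RT /R_tree /sum_orders (sum_subtrees_split _ v) natrD.
  by rewrite addrAC subrr add0r.
have -> : Nv * NT - Nv ^+ 2 + NT - Nv = (Nv + 1) * m by rewrite -dN; ring.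
rewrite dN dR.
have main : 3 * s <= (Nv + 1) * m.
  have := tree_global_mean_bound v hT.
  by rewrite -(ler_nat rat) !natrM -[(N_at e v).+1%:R]natr1.
split=> // V_gt1.
have m_gt0 : 0 < m by rewrite ltr0n subtrees_avoiding_gt0.
have equiv : 3 * s <= (Nv + 1) * m <-> s / m <= (Nv + 1) / 3.
  by rewrite ler_pdivrMr // mulrAC ler_pdivlMr // mulrC.
by split=> //; split=> //; apply/equiv.
Qed.
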